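(* Let $G$ be a finitely generated infinite group with finite symmetric generating set $S$ and let $1\le p<\infty$. Suppose there exists a sequence $\{\alpha_n\}$ in $L^p(G)$ such that $\|\alpha_n\|_{D(p)}\to 0$ as $n\to\infty$ and such that, for each $x\in G$, the sequence $\{\alpha_n(x)\}$ does not converge to $0$. Then $\overline{H}^1_{(p)}(G)=0$.
   Context: Symmetric means $S=S^{-1}$. $L^p(G)$ is the Banach space of functions $\alpha:G\to\mathbb{C}$ with $\|\alpha\|_p=(\sum_{x\in G}|\alpha(x)|^p)^{1/p}<\infty$. For $\beta:G\to\mathbb{C}$ and $g\in G$ write $(\beta*(g-1))(x)=\beta(xg^{-1})-\beta(x)$. $D^p(G)$ is the space of functions $\beta:G\to\mathbb{C}$ with $\beta*(g-1)\in L^p(G)$ for all $g\in S$, a Banach space under $\|\beta\|_{D^p(G)}=(\sum_{g\in S}\|\beta*(g-1)\|_p^p+|\beta(e)|^p)^{1/p}$, where $e$ is the identity of $G$. Also $\|\beta\|_{D(p)}=(\sum_{g\in S}\|\beta*(g-1)\|_p^p)^{1/p}$. The first reduced $L^p$-cohomology space is $\overline{H}^1_{(p)}(G)=Z^1/\overline{B^1}$, where, with $G$ acting on the right on $L^p(G)$ by right translation $\alpha_g(x)=\alpha(xg^{-1})$, $Z^1$ is the space of maps $\delta:G\to L^p(G)$ with $\delta(gh)=(\delta(g))_h+\delta(h)$, topologized by pointwise norm convergence, and $B^1$ is the subspace of maps $\delta(g)=\alpha_g-\alpha$ with $\alpha\in L^p(G)$. Via $\beta\mapsto(g\mapsto\beta*(g-1))$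 it is identified with $D^p(G)/\overline{L^p(G)\oplus\mathbb{C}}$, where $\mathbb{C}$ denotes the constant functions and the closure is taken in $D^p(G)$. *)

(* Defs.v *)
From HB Require Import structures.
From mathcomp Require Import all_boot all_order all_algebra finmap.
From mathcomp Require Import complex ring.
From mathcomp Require Import all_classical all_reals all_analysis.
Set Implicit Arguments.
Unset Strict Implicit.
Unset Printing Implicit Defensive.
Import Order.TTheory GRing.Theory Num.Theory.
Import numFieldNormedType.Exports Normc.
Local Open Scope classical_set_scope.
Local Open Scope ring_scope.
Local Open Scope complex_scope.

Section GeneratingSets.
Variable G : groupType.
Implicit Type S : {fset G}.

Definition symmetric_fset S := forall g : G, (g^-1%g \in S) = (g \in S).

Definition generates S :=
  forall H : {pred G}, group_closed H -> {subset S <= H} -> forall x, x \in H.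

End GeneratingSets.

Section Norms.
Variables (R : realType) (G : groupType).
Implicit Types (p : R) (b : G -> R[i]) (S : {fset G}).

(* [+oo] when the sum diverges *)
Definition lp_norm p b : \bar R :=
  ((\esum_(x in [set: G]) (normc (b x) `^ p)%:E) `^ p^-1)%E.

Definition rtrans (g : G) b : G -> R[i] := fun x => b (x * g^-1)%g.

(* b * (g - 1) *)
Definition rdiff b (g : G) : G -> R[i] := rtrans g b - b.

Definition D_seminorm p S b : \bar R :=
  ((\sum_(g <- S) lp_norm p (rdiff b g) `^ p) `^ p^-1)%E.

End Norms.

Section EsumFacts.
Variables (R : realType) (T : choiceType).
Implicit Types a b : T -> \bar R.
Local Open Scope ereal_scope.

Lemma esumZl (c : R) a : (0 <= c)%R -> (forall x, 0 <= a x) ->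
  \esum_(x in [set: T]) (c%:E * a x) = c%:E * \esum_(x in [set: T]) a x.
Proof.
move=> c0 a0; rewrite /esum -ereal_supZl//.
  rewrite image_comp; congr ereal_sup; apply: eq_imagel => X _ /=.
  by rewrite ge0_mule_fsumr.
by apply/set0P; exists (\sum_(x \in set0) a x); exists set0.
Qed.

End EsumFacts.

Section LpFacts.
Variables (R : realType) (G : groupType) (p : R).
Hypothesis p1 : 1 <= p.
Implicit Types f g : G -> R[i].

Let p0 : 0 < p. Proof. exact: lt_le_trans p1. Qed.

Let S f : \bar R := \esum_(x in [set: G]) (normc (f x) `^ p)%:E.

Let normc_ge0 (z : R[i]) : 0 <= normc z.
Proof. by case: z => a b; exact: sqrtr_ge0. Qed.

Let S_ge0 f : (0 <= S f)%E.
Proof. by apply: esum_ge0 => x _; rewrite lee_fin powR_ge0. Qed.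

Lemma lp_norm_ge0 f : (0 <= lp_norm p f)%E.
Proof. exact: poweR_ge0. Qed.

Lemma lp_norm_powR f : (lp_norm p f `^ p)%E = S f.
Proof. by rewrite /lp_norm -poweRrM mulVf ?gt_eqF// poweRe1 ?S_ge0. Qed.

Lemma lp_norm_rtrans (h : G) f : lp_norm p (rtrans h f) = lp_norm p f.
Proof.
rewrite /lp_norm; congr (_ `^ _)%E; symmetry.
apply: (reindex_esum setT setT (fun x => (x * h^-1)%g)).
by rewrite setTT_bijective; exists (fun x => (x * h)%g) => x; rewrite /= (mulgVK, mulgK).
Qed.

Lemma lp_normZ (c : R[i]) f :
  lp_norm p (c *: f) = ((normc c)%:E * lp_norm p f)%E.
Proof.
have -> : lp_norm p (c *: f) = (((normc c `^ p)%:E * S f) `^ p^-1)%E.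
  have pow_ge0 x : (0 <= (normc (f x) `^ p)%:E)%E by rewrite lee_fin powR_ge0.
  rewrite /lp_norm /S -(esumZl (powR_ge0 _ _) pow_ge0); congr (_ `^ _)%E.
  by apply: eq_esum => x _; rewrite -EFinM -powRM// -normcM.
by rewrite poweRM ?lee_fin ?powR_ge0 ?S_ge0// poweR_EFin -powRrM divff ?gt_eqF// powRr1//.
Qed.

Lemma lp_norm_eq0 f : lp_norm p f = 0%E -> f = 0.
Proof.
move=> /eqP f0; apply/funext => x; apply: eq0_normc; apply/eqP.
have {f0}Sf : S f = 0%E by rewrite -lp_norm_powR (eqP f0) poweR0r// gt_eqF.
have : ((normc (f x) `^ p)%:E <= S f)%E.
  apply: esum_ge; exists [set x]; first by split.
  by rewrite fsbig_set1.
rewrite Sf lee_fin => fx.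
have /eqP : normc (f x) `^ p = 0.
  by apply/eqP; rewrite eq_le fx powR_ge0.
by rewrite powR_eq0 => /andP[].
Qed.

Lemma lp_norm0 : lp_norm p (0 : G -> R[i]) = 0%E.
Proof. by rewrite -(scale0r (0 : G -> R[i])) lp_normZ normc0 mul0e. Qed.

Let weighted_convexity (A B a b : R) : 0 < A -> 0 < B -> 0 <= a -> 0 <= b ->
  (a + b) `^ p <= (A + B) `^ p *
    (A / (A + B) / A `^ p * a `^ p + B / (A + B) / B `^ p * b `^ p).
Proof.
move=> A0 B0 a0 b0; have AB0 : 0 < A + B by exact: addr_gt0.
have t01 : 0 <= A / (A + B) <= 1.
  apply/andP; split; first by rewrite divr_ge0 ?ltW.
  by rewrite ler_pdivrMr// mul1r lerDl ltW.
have mem0y (x : R) : 0 <= x -> x \in (`[0, +oo[%classic : set R).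
  by move=> x0; rewrite inE /= in_itv/= x0.
have aA : 0 <= a / A by rewrite divr_ge0// ltW.
have bB : 0 <= b / B by rewrite divr_ge0// ltW.
have := @convex_powR R p p1 (Itv01 (andP t01).1 (andP t01).2)
  _ _ (mem0y _ aA) (mem0y _ bB).
rewrite !convRE/= => H.
have ABE : unstable.onem (A / (A + B)) = B / (A + B).
  by rewrite /unstable.onem; field; rewrite gt_eqF.
have E : A / (A + B) * (a / A) + B / (A + B) * (b / B) = (a + b) / (A + B).
  by field; rewrite !gt_eqF.
have powRdiv (x y : R) : 0 <= x -> 0 < y -> (x / y) `^ p = x `^ p / y `^ p.
  move=> x0 y0; apply: (canRL (mulfK _)); first by rewrite gt_eqF ?powR_gt0.
  by rewrite -powRM ?divr_ge0 ?(ltW y0)// divfK ?gt_eqF.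
move: H; rewrite [conv _ _ _]convRE/= ABE E !powRdiv ?addr_ge0//.
rewrite ler_pdivrMr ?powR_gt0// => /le_trans; apply.
rewrite le_eqVlt; apply/orP; left; apply/eqP.
by field; rewrite !gt_eqF ?powR_gt0.
Qed.

Lemma lp_normD f g :
  (lp_norm p (f + g)%R <= lp_norm p f + lp_norm p g)%E.
Proof.
have := lp_norm_ge0 f; have := lp_norm_ge0 g.
case ef : (lp_norm p f) => [A| |]//; case eg : (lp_norm p g) => [B| |]//;
  rewrite ?leey// !lee_fin.
rewrite le0r => /orP[/eqP B0 _|B0].
  by move: eg; rewrite B0 => /lp_norm_eq0 ->; rewrite addr0 ef adde0.
rewrite le0r => /orP[/eqP A0|A0].
  by move: ef; rewrite A0 => /lp_norm_eq0 ->; rewrite add0r eg add0e.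
have AB0 : 0 < A + B by exact: addr_gt0.
have Sf : S f = (A `^ p)%:E by rewrite -lp_norm_powR ef.
have Sg : S g = (B `^ p)%:E by rewrite -lp_norm_powR eg.
suff SD : (S (f + g)%R <= ((A + B) `^ p)%R%:E)%E.
  rewrite /lp_norm; apply: (le_trans (gt0_ler_poweR _ _ _ SD)).
  - by rewrite invr_ge0 ltW.
  - by rewrite in_itv/= S_ge0 leey.
  - by rewrite in_itv/= lee_fin powR_ge0 leey.
  by rewrite poweR_EFin -powRrM divff ?gt_eqF// powRr1// ltW.
pose u := (A + B) `^ p * (A / (A + B) / A `^ p).
pose v := (A + B) `^ p * (B / (A + B) / B `^ p).
have u0 : 0 <= u by rewrite /u !mulr_ge0 ?invr_ge0 ?powR_ge0 ?ltW.
have v0 : 0 <= v by rewrite /v !mulr_ge0 ?invr_ge0 ?powR_ge0 ?ltW.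
apply: (@le_trans _ _ (u%:E * S f + v%:E * S g)%E).
  have pow_ge0 (h : G -> R[i]) x : (0 <= (normc (h x) `^ p)%:E)%E.
    by rewrite lee_fin powR_ge0.
  rewrite /S -(esumZl u0 (pow_ge0 f)) -(esumZl v0 (pow_ge0 g)) -esumD.
  - apply: le_esum => x _; rewrite -!EFinM -EFinD lee_fin.
    apply: (@le_trans _ _ ((normc (f x) + normc (g x)) `^ p)).
      rewrite ge0_ler_powR ?nnegrE ?addr_ge0 ?(ltW p0)//.
      exact: le_normcD.
    apply: (le_trans (weighted_convexity A0 B0 _ _)) => //.
    by rewrite mulrDr /u /v !mulrA.
  - by move=> x _; apply: mule_ge0.
  - by move=> x _; apply: mule_ge0.
rewrite Sf Sg -!EFinM -EFinD lee_fin /u /v le_eqVlt; apply/orP; left.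
by apply/eqP; field; rewrite !gt_eqF ?powR_gt0.
Qed.

End LpFacts.

Section LpSpace.
Variables (R : realType) (G : groupType) (p : R).

(* The proof that 1 <= p is an index, so that the instances below can use it. *)
Definition lp_pred (p1 : 1 <= p) : {pred G -> R[i]} :=
  [pred f | (lp_norm p f < +oo)%E].

Variable p1 : 1 <= p.

Lemma lp_pred_submod_closed : submod_closed (lp_pred p1).
Proof.
split=> [|c f g]; rewrite !inE /= ?lp_norm0 ?ltry// => fp gp.
apply: (le_lt_trans (lp_normD p1 _ _)); rewrite lte_add_pinfty//.
rewrite lp_normZ//; move: fp (lp_norm_ge0 p f).
by case: lp_norm => [r| |]// _ _; rewrite -EFinM ltry.
Qed.

HB.instance Definition _ :=
  GRing.isSubmodClosed.Build R[i] (G -> R[i]) (lp_pred p1)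
    lp_pred_submod_closed.

Record Lp := MkLp { Lp_fun :> G -> R[i]; _ : Lp_fun \in lp_pred p1 }.

HB.instance Definition _ := [isSub for Lp_fun].
HB.instance Definition _ := [Choice of Lp by <:].
HB.instance Definition _ := [SubChoice_isSubLmodule of Lp by <:].

Lemma Lp_norm_fin (a : Lp) : (fine (lp_norm p a))%:E = lp_norm p a.
Proof.
apply: fineK; case: a => a /=; rewrite inE/= => ap.
by rewrite ge0_fin_numE ?lp_norm_ge0.
Qed.

(* Norms of R[i]-modules are R[i]-valued in the library. *)
Definition Lp_norm (a : Lp) : R[i] := (fine (lp_norm p a))%:C.

Lemma Lp_normD (a b : Lp) : Lp_norm (a + b) <= Lp_norm a + Lp_norm b.
Proof.
rewrite /Lp_norm -rmorphD lecR -lee_fin EFinD !Lp_norm_fin.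
exact: lp_normD.
Qed.

Lemma Lp_normZ (c : R[i]) (a : Lp) : Lp_norm (c *: a) = `|c| * Lp_norm a.
Proof.
rewrite /Lp_norm -[X in _ = X * _]/((normc c)%:C) -rmorphM; congr (_%:C).
by apply: EFin_inj; rewrite EFinM !Lp_norm_fin -lp_normZ.
Qed.

Lemma Lp_norm_eq0 (a : Lp) : Lp_norm a = 0 -> a = 0.
Proof.
move=> [a0]; apply: val_inj; apply: (lp_norm_eq0 p1).
by rewrite -Lp_norm_fin a0.
Qed.

HB.instance Definition _ :=
  Lmodule_isNormed.Build R[i] Lp Lp_normD Lp_normZ Lp_norm_eq0.

Lemma Lp_act_subproof (a : Lp) (g : G) : rtrans g a \in lp_pred p1.
Proof. by rewrite inE /= lp_norm_rtrans; case: a. Qed.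

Definition Lp_act (a : Lp) (g : G) : Lp := MkLp (Lp_act_subproof a g).

End LpSpace.

Arguments Lp {R} G {p} p1.

(* {ptws G -> _} carries the topology of pointwise convergence *)
Definition cochains (R : realType) (G : groupType) (p : R) (p1 : 1 <= p) :=
  {ptws G -> Lp G p1}.
Arguments cochains {R} G {p} p1.

Section Cohomology.
Variables (R : realType) (G : groupType) (p : R) (p1 : 1 <= p).

Definition Z1 : set (cochains G p1) :=
  [set d | forall g h : G, d (g * h)%g = Lp_act (d g) h + d h].

Definition B1 : set (cochains G p1) :=
  [set d | exists a : Lp G p1, forall g, d g = Lp_act a g - a].

(* closure in Z1 for the subspace topology *)
Definition B1_closure : set (cochains G p1) := Z1 `&` closure B1.

Definition cohomology_class (d : cochains G p1) : set (cochains G p1) :=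
  [set ((fun g => d g + b g) : cochains G p1) | b in B1_closure].

(* the quotient Z1 / closure B1, as the set of cosets *)
Definition reduced_H1 : set (set (cochains G p1)) := cohomology_class @` Z1.

Definition zero_class : set (cochains G p1) := cohomology_class (fun=> 0).

End Cohomology.

Arguments Z1 {R} G {p} p1 _.
Arguments B1 {R} G {p} p1 _.
Arguments B1_closure {R} G {p} p1 _.
Arguments reduced_H1 {R} G {p} p1 _.
Arguments zero_class {R} G {p} p1 _.

(* Main.v *)
(** Since alpha_n(1) does not tend to 0, along a subsequence we may divide by
    alpha_n(1) and truncate to get uniformly bounded a_n in L^p with
    a_n(1) = 1 and a_n * (g - 1) -> 0 in L^p, for g in S and hence for all g
    by the cocycle identity; so a_n -> 1 pointwise.  A cocycle d is
    g |-> b * (g - 1) with b(x) = d(x^-1)(1).  Truncating b at height N gives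
    bounded functions b_N with b_N * (g - 1) -> b * (g - 1) by dominated
    convergence, and a_n b_N is in L^p with (a_n b_N) * (g - 1) ->
    b_N * (g - 1) as n tends to infinity by the Leibniz rule and dominated
    convergence again.  Hence every cocycle lies in the closure of B^1. *)
Require Import Defs.
From HB Require Import structures.
From mathcomp Require Import all_boot all_order all_algebra finmap.
From mathcomp Require Import complex ring lra.
From mathcomp Require Import all_classical all_reals all_analysis.
Set Implicit Arguments.
Unset Strict Implicit.
Unset Printing Implicit Defensive.
Import Order.TTheory GRing.Theory Num.Theory.
Import numFieldNormedType.Exports Normc.
Local Open Scope classical_set_scope.
Local Open Scope ring_scope.
Local Open Scope complex_scope.

(** * Limits to 0 in the extended reals and dominated convergence for sums *)

Lemma ge0_cvge0P (R : realType) (v : nat -> \bar R) :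
  (forall n, (0 <= v n)%E) ->
  (v n @[n --> \oo] --> 0%E) <->
  (forall e : R, 0 < e -> \forall n \near \oo, (v n <= e%:E)%E).
Proof.
move=> v0; split=> [/fine_cvgP[vfin /cvgr0Pnorm_le v_to0] e e0|ve].
  near=> n; have vn : v n \is a fin_num by near: n.
  rewrite -(fineK vn) lee_fin -[leLHS]ger0_norm ?fine_ge0//.
  by near: n; exact: v_to0.
have vfin : \forall n \near \oo, v n \is a fin_num.
  near=> n; rewrite ge0_fin_numE//; apply: (@le_lt_trans _ _ 1%:E).
    by near: n; exact: ve.
  exact: ltry.
apply/fine_cvgP; split=> //; apply/cvgr0Pnorm_le => e e0.
near=> n; have vn : v n \is a fin_num by near: n.
rewrite ger0_norm ?fine_ge0//= -lee_fin fineK//.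
by near: n; exact: ve.
Unshelve. all: by end_near. Qed.

(** A finite set [A] carries all of the sum of [f] but [e / 2]. Off [A] the tail of [f] bounds that
    of [u n] for every [n]; on [A] a finite sum tends to 0 term by term. *)
Lemma esum_dominated_cvg0 (R : realType) (T : choiceType) (f : T -> R)
    (u : nat -> T -> R) :
  (forall n x, 0 <= u n x <= f x) ->
  (\esum_(x in [set: T]) (f x)%:E < +oo)%E ->
  (forall x, u n x @[n --> \oo] --> 0) ->
  \esum_(x in [set: T]) (u n x)%:E @[n --> \oo] --> 0%E.
Proof.
move=> uf fy u0.
have f0 x : 0 <= f x by case/andP: (uf 0 x); exact: le_trans.
have u_ge0 n x : 0 <= u n x by case/andP: (uf n x).
have ffin : \esum_(x in [set: T]) (f x)%:E \is a fin_num.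
  by rewrite ge0_fin_numE// esum_ge0// => x _; rewrite lee_fin.
apply/ge0_cvge0P => [n|e e0]; first by rewrite esum_ge0// => x _; rewrite lee_fin.
have e20 : 0 < e / 2 by rewrite divr_gt0.
have [_ [A [finA _] <-] ltA] := ub_ereal_sup_adherent e20 ffin.
have tail_f : (\esum_(x in ~` A) (f x)%:E <= (e / 2)%:E)%E.
  move: ltA; rewrite -/(esum _ _) (esumID A); last by move=> x _; rewrite lee_fin.
  rewrite !setTI esum_fset//; last by move=> x _; rewrite lee_fin.
  have : (0 <= \esum_(x in ~` A) (f x)%:E)%E by rewrite esum_ge0// => x _; rewrite lee_fin.
  move: ffin; rewrite (esumID A); last by move=> x _; rewrite lee_fin.
  rewrite !setTI esum_fset//; last by move=> x _; rewrite lee_fin.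
  rewrite fin_numD => /andP[/fineK <- /fineK <-] _.
  rewrite -!EFinD lte_fin lee_fin.
  lra.
have sumu0 : (\sum_(x \in A) (u n x)%:E)%E @[n --> \oo] --> 0%E.
  under eq_fun do rewrite fsbig_finite//.
  have : (\sum_(x <- fset_set A) (u n x)%:E)%E @[n --> \oo] -->
      (\sum_(x <- fset_set A) (0 : \bar R))%E.
    apply: cvg_nnesum => x _; first by near=> n; rewrite lee_fin.
    by apply: cvg_EFin; [near=> n|exact: u0].
  by rewrite big1.
have sumu_ge0 n : (0 <= \sum_(x \in A) (u n x)%:E)%E.
  by rewrite fsume_ge0// => x _; rewrite lee_fin.
move/(ge0_cvge0P sumu_ge0): sumu0 => /(_ _ e20); apply: filterS => n un.
rewrite (esumID A); last by move=> x _; rewrite lee_fin.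
rewrite !setTI esum_fset//; last by move=> x _; rewrite lee_fin.
rewrite [e]splitr EFinD; apply: leeD => //.
apply: le_trans tail_f; apply: le_esum => x _; rewrite lee_fin.
by case/andP: (uf n x).
Unshelve. all: by end_near. Qed.

(** The pointwise topology is the supremum of those induced by the evaluations, which are onto
    because of the constant functions. *)
Lemma ptws_cvg (U : Type) (V : topologicalType) (F : set_system (U -> V))
    (f : U -> V) : Filter F ->
  (forall t, g t @[g --> F] --> f t) -> {ptws, F --> f}.
Proof.
move=> FF pf; apply/cvg_sup => i; apply/cvg_image.
  by rewrite eqEsubset; split=> v // _; exists (cst v).
move=> W /pf Q; exists (@^~ i @^-1` W) => //.
by rewrite eqEsubset; split => [j [? + <-//]|j Wj]; exists (fun _ => j).
Qed.

(** * Truncation of complex numbers *)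

Section ComplexClamp.
Variable R : realType.
Implicit Types (M a b : R) (z w : R[i]).

Lemma normc_ge0 z : 0 <= normc z.
Proof. by case: z => a b; exact: sqrtr_ge0. Qed.

Definition clamp M a : R := Num.max (- M) (Num.min a M).

(* Clamping both coordinates is 1-Lipschitz and avoids the radial retraction. *)
Definition cclamp M z : R[i] := clamp M (complex.Re z) +i* clamp M (complex.Im z).

(** Squares are compared because they add up under the square root in [normc]. *)
Lemma clamp_sqr_dist M a b : (clamp M a - clamp M b) ^+ 2 <= (a - b) ^+ 2.
Proof.
rewrite -[leLHS]real_normK ?num_real// -[leRHS]real_normK ?num_real//.
rewrite lerXn2r ?nnegrE ?normr_ge0// ler_norml /clamp; apply/andP; split;
  case: (ltrP a M) => ?; case: (ltrP b M) => ?;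
  case: (ger0P (a - b)) => ?; case: (ltrP (- M) a) => ?;
  case: (ltrP (- M) b) => ?; case: (ltrP (- M) M) => ?; lra.
Qed.

Lemma clamp_sqr_le M a : 0 <= M -> clamp M a ^+ 2 <= M ^+ 2.
Proof.
move=> M0; rewrite -[leLHS]real_normK ?num_real// lerXn2r ?nnegrE//.
rewrite ler_norml /clamp le_max lexx/= ge_max ge_min lexx orbT andbT.
lra.
Qed.

Lemma clamp_id M a : `|a| <= M -> clamp M a = a.
Proof.
by rewrite ler_norml => /andP[Ma aM]; rewrite /clamp min_l// max_r.
Qed.

Lemma cclamp_dist M z w : normc (cclamp M z - cclamp M w) <= normc (z - w).
Proof.
case: z w => [a b] [c d]; rewrite /cclamp/= ler_sqrt.
  by apply: lerD; exact: clamp_sqr_dist.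
by rewrite addr_ge0// sqr_ge0.
Qed.

(** The factor 2 replaces the sharp constant, the square root of 2. *)
Lemma cclamp_bound M z : 0 <= M -> normc (cclamp M z) <= 2 * M.
Proof.
move=> M0; rewrite /cclamp/= -(ger0_norm (mulr_ge0 _ M0))// -sqrtr_sqr.
rewrite ler_sqrt ?sqr_ge0//.
have := clamp_sqr_le (complex.Re z) M0; have := clamp_sqr_le (complex.Im z) M0.
by rewrite exprMn; have := sqr_ge0 M; nra.
Qed.

Lemma cclamp_id M z : normc z <= M -> cclamp M z = z.
Proof.
case: z => a b /= nM; rewrite /cclamp/= !clamp_id//; apply: le_trans nM;
  by rewrite -sqrtr_sqr ler_sqrt ?addr_ge0 ?sqr_ge0// (lerDl, lerDr) sqr_ge0.
Qed.

Lemma cclamp0 M : 0 <= M -> cclamp M 0 = 0.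
Proof. by move=> M0; rewrite cclamp_id// normc0. Qed.

End ComplexClamp.

(** * Comparison and convergence in the p-norm *)

Section LpNorm.
Variables (R : realType) (G : groupType) (p : R).
Hypothesis p1 : 1 <= p.
Implicit Types f u : G -> R[i].

Let p0 : 0 < p. Proof. exact: lt_le_trans p1. Qed.

Lemma lp_norm_le f u : (forall x, normc (u x) <= normc (f x)) ->
  (lp_norm p u <= lp_norm p f)%E.
Proof.
move=> uf; rewrite /lp_norm; apply: gt0_ler_poweR.
- by rewrite invr_ge0 ltW.
- by rewrite in_itv/= leey andbT esum_ge0// => x _; rewrite lee_fin powR_ge0.
- by rewrite in_itv/= leey andbT esum_ge0// => x _; rewrite lee_fin powR_ge0.
by apply: le_esum => x _; rewrite lee_fin ge0_ler_powR ?nnegrE ?normc_ge0 ?(ltW p0).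
Qed.

Lemma normcR (c : R) : 0 <= c -> normc c%:C = c.
Proof. by move=> c0; rewrite /= expr0n/= addr0 sqrtr_sqr ger0_norm. Qed.

Lemma lp_norm_leM (c : R) f u : 0 <= c ->
  (forall x, normc (u x) <= c * normc (f x)) ->
  (lp_norm p u <= c%:E * lp_norm p f)%E.
Proof.
move=> c0 uf; rewrite -[c in leRHS]normcR// -lp_normZ//.
apply: lp_norm_le => x; apply: le_trans (uf x) _.
by rewrite -[c in leLHS]normcR// -normcM.
Qed.

(** One term is at most the whole sum. This later turns convergence in norm into pointwise
    convergence. *)
Lemma normc_le_lp_norm f x : ((normc (f x))%:E <= lp_norm p f)%E.
Proof.
have -> : (normc (f x))%:E = ((normc (f x) `^ p)%:E `^ p^-1)%E.
  by rewrite poweR_EFin -powRrM divff ?gt_eqF// powRr1// normc_ge0.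
apply: gt0_ler_poweR.
- by rewrite invr_ge0 ltW.
- by rewrite in_itv/= lee_fin powR_ge0 leey.
- by rewrite in_itv/= leey andbT esum_ge0// => y _; rewrite lee_fin powR_ge0.
by apply: esum_ge; exists [set x]; rewrite ?fsbig_set1//; split.
Qed.

(** Dominated convergence applies to the p-th powers, with the p-th power of [c *: f] as majorant;
    p-th roots are then taken. *)
Lemma lp_norm_dominated_cvg0 (c : R) f (u : nat -> G -> R[i]) : 0 <= c ->
  (lp_norm p f < +oo)%E ->
  (forall n x, normc (u n x) <= c * normc (f x)) ->
  (forall x, normc (u n x) @[n --> \oo] --> 0) ->
  lp_norm p (u n) @[n --> \oo] --> 0%E.
Proof.
move=> c0 fy uf u0.
have cfy : (\esum_(x in [set: G]) (normc ((c%:C *: f) x) `^ p)%:E < +oo)%E.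
  rewrite -lp_norm_powR//; apply: poweR_lty.
  rewrite lp_normZ// normcR//.
  by move: fy (lp_norm_ge0 p f); case: lp_norm => [r| |]// _ _; rewrite -EFinM ltry.
have : \esum_(x in [set: G]) (normc (u n x) `^ p)%:E @[n --> \oo] --> 0%E.
  apply: (esum_dominated_cvg0 _ cfy) => [n x|x].
    rewrite powR_ge0 ge0_ler_powR ?nnegrE ?normc_ge0 ?(ltW p0)//.
    by apply: le_trans (uf n x) _; rewrite -[c in leLHS]normcR// -normcM.
  apply/cvgr0Pnorm_le => e e0.
  move/cvgr0Pnorm_le: (u0 x) => /(_ (e `^ p^-1)); rewrite powR_gt0// => /(_ isT).
  apply: filterS => n; rewrite (ger0_norm (normc_ge0 _)) ger0_norm ?powR_ge0// => ue.
  rewrite -[e]powRr1 ?(ltW e0)// -(@mulVf _ p) ?gt_eqF// powRrM.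
  by rewrite ge0_ler_powR ?nnegrE ?normc_ge0 ?powR_ge0 ?(ltW p0).
have S0 n : (0 <= \esum_(x in [set: G]) (normc (u n x) `^ p)%:E)%E.
  by rewrite esum_ge0// => x _; rewrite lee_fin powR_ge0.
move/(ge0_cvge0P S0) => SU; apply/ge0_cvge0P => [n|e e0]; first exact: lp_norm_ge0.
have := SU _ (powR_gt0 p e0); apply: filterS => n un.
rewrite (_ : e%:E = ((e `^ p)%:E `^ p^-1)%E); last first.
  by rewrite poweR_EFin -powRrM divff ?gt_eqF// powRr1// ltW.
apply: gt0_ler_poweR un.
- by rewrite invr_ge0 ltW.
- by rewrite in_itv/= S0 leey.
- by rewrite in_itv/= lee_fin powR_ge0 leey.
Qed.

Lemma Lp_cvg (u : nat -> Lp G p1) (l : Lp G p1) :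
  lp_norm p ((u n : G -> R[i]) - l) @[n --> \oo] --> 0%E -> u n @[n --> \oo] --> l.
Proof.
move=> /ge0_cvge0P => /(_ (fun=> lp_norm_ge0 _ _)) ul.
apply/cvgrPdist_le => e e0.
(* Norms are [R[i]]-valued, so the radius [e] is complex; being positive, it is real. *)
have eE : e = (complex.Re e)%:C by case: e e0 => a b /andP[/eqP/= ->].
have Re0 : 0 < complex.Re e by move: e0; rewrite {1}eE ltcR.
have := ul _ Re0; apply: filterS => n un.
rewrite distrC eE -[leLHS]/(Lp_norm (u n - l)) lecR -lee_fin Lp_norm_fin.
exact: un.
Qed.

End LpNorm.

(** * Coboundaries of functions and their approximation from L^p *)

Section Approximation.
Variables (R : realType) (G : groupType) (p : R).
Hypothesis p1 : 1 <= p.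
Implicit Types (a b : G -> R[i]) (g h x : G).

Let p0 : 0 < p. Proof. exact: lt_le_trans p1. Qed.

Lemma rdiffM b g h : rdiff b (g * h)%g = rtrans h (rdiff b g) + rdiff b h.
Proof.
apply/funext => x; rewrite /rdiff /rtrans !fctE invgM mulgA.
by rewrite subrKA.
Qed.

(** The elements [g] for which the norms tend to 0 form a subgroup. It contains [S], since each term
    of the sum is bounded by the seminorm. *)
Lemma rdiff_cvg0 (S : {fset G}) (b : nat -> G -> R[i]) : generates S ->
  D_seminorm p S (b n) @[n --> \oo] --> 0%E ->
  forall g, lp_norm p (rdiff (b n) g) @[n --> \oo] --> 0%E.
Proof.
move=> S_gen bD0.
pose P g := `[< lp_norm p (rdiff (b n) g) @[n --> \oo] --> 0%E >].
suff PG g : g \in (P : {pred G}) by move=> g; exact/asboolP/PG.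
apply: S_gen => [|h hS]; last first.
  apply/asboolP; apply: squeeze_cvge (@cvg_cst _ 0%E _ _ _) bD0.
  apply: nearW => n; rewrite lp_norm_ge0/=.
  have -> : lp_norm p (rdiff (b n) h) = ((lp_norm p (rdiff (b n) h) `^ p) `^ p^-1)%E.
    by rewrite -poweRrM divff ?gt_eqF// poweRe1// lp_norm_ge0.
  have sum_ge0 (s : seq G) : (0 <= \sum_(g <- s) lp_norm p (rdiff (b n) g) `^ p)%E.
    by apply: sume_ge0 => x _; exact: poweR_ge0.
  apply: gt0_ler_poweR.
  - by rewrite invr_ge0 ltW.
  - by rewrite in_itv/= poweR_ge0 leey.
  - by rewrite in_itv/= leey andbT sum_ge0.
  by rewrite (big_rem h)//= leeDl.
split=> [|h k /asboolP Ph /asboolP Pk].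
  apply/asboolP; rewrite (_ : (fun n => _) = cst 0%E); first exact: cvg_cst.
  apply/funext => n; rewrite (_ : rdiff _ _ = 0) ?lp_norm0//.
  by apply/funext => x; rewrite /rdiff /rtrans !fctE invg1 mulg1 subrr.
apply/asboolP.
(* Closure under [h / k]: the cocycle identity expresses a translate of the difference at [h / k] by
   those at [h] and [k], and translation is isometric. *)
have hkE n : rdiff (b n) h = rtrans k (rdiff (b n) (h / k)%g) + rdiff (b n) k.
  by rewrite -rdiffM mulgVK.
have H : (lp_norm p (rdiff (b n) h) + lp_norm p (rdiff (b n) k))%E @[n --> \oo] --> 0%E.
  by rewrite -[X in _ --> X]adde0; apply: cvgeD.
apply: squeeze_cvge (@cvg_cst _ 0%E _ _ _) H.
apply: nearW => n; rewrite lp_norm_ge0/= -(lp_norm_rtrans p k).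
rewrite (_ : rtrans k _ = rdiff (b n) h + (-1) *: rdiff (b n) k).
  apply: le_trans (lp_normD p1 _ _) _; apply: leeD => //.
  by rewrite lp_normZ// -[(-1)%R]mulN1r mulr1 normcN normc1 mul1e.
by rewrite hkE scaleN1r addrK.
Qed.

Lemma lp_pred_leM (c : R) a b : 0 <= c -> b \in lp_pred p1 ->
  (forall x, normc (a x) <= c * normc (b x)) -> a \in lp_pred p1.
Proof.
rewrite !inE /= => c0 by_ ab.
apply: le_lt_trans (lp_norm_leM p1 c0 ab) _.
by move: by_ (lp_norm_ge0 p b); case: lp_norm => [r| |]// _ _; rewrite -EFinM ltry.
Qed.

(** The approximants are the products of [a n] and [b], in L^p because [b] is bounded. Of the two
    Leibniz terms of the error, one tends to 0 pointwise and is dominated by 3 (that is, 1 + 2)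
    times [rdiff b g]; the other has norm at most [K] times that of [rdiff (a n) g]. *)
Lemma bounded_approximation (a : nat -> Lp G p1) b (K : R) : 0 <= K ->
  (forall n x, normc (a n x) <= 2) ->
  (forall x, normc (1 - a n x) @[n --> \oo] --> 0) ->
  (forall g, lp_norm p (rdiff (a n) g) @[n --> \oo] --> 0%E) ->
  (forall x, normc (b x) <= K) ->
  (forall g, (lp_norm p (rdiff b g) < +oo)%E) ->
  exists A : nat -> Lp G p1, forall g,
    lp_norm p (rdiff (A n) g - rdiff b g) @[n --> \oo] --> 0%E.
Proof.
move=> K0 a2 a1 da0 bK dby.
have abL n : (fun x => a n x * b x) \in lp_pred p1.
  apply: (lp_pred_leM K0 (valP (a n))) => x.
  by rewrite normcM mulrC ler_wpM2r// normc_ge0.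
exists (fun n => MkLp (abL n)) => g.
(* With y = x g^-1:
   a(y) b(y) - a(x) b(x) - (b(y) - b(x)) = - (1 - a(y)) (b(y) - b(x)) + b(x) (a(y) - a(x)). *)
pose u n x := (1 - a n (x * g^-1)%g) * rdiff b g x.
have u0 : lp_norm p (u n) @[n --> \oo] --> 0%E.
  apply: (@lp_norm_dominated_cvg0 _ _ _ p1 3 (rdiff b g)) => // [n x|x].
    rewrite normcM ler_wpM2r ?normc_ge0//.
    apply: le_trans (le_normcD _ _) _; rewrite normcN normc1.
    by have := a2 n (x * g^-1)%g; lra.
  under eq_fun do rewrite normcM.
  by rewrite -(mul0r (normc (rdiff b g x))); apply: cvgM => //; exact: cvg_cst.
have H : (lp_norm p (u n) + K%:E * lp_norm p (rdiff (a n) g))%E @[n --> \oo] --> 0%E.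
  rewrite -[X in _ --> X]adde0; apply: cvgeD => //.
  by rewrite -(mule0 K%:E); apply: cvgeZl.
apply: squeeze_cvge (@cvg_cst _ 0%E _ _ _) H.
apply: nearW => n; rewrite lp_norm_ge0/=.
rewrite (_ : _ - _ = (-1) *: u n + (fun x => b x * rdiff (a n) g x)); last first.
  apply/funext => x; rewrite /u /rdiff /rtrans !fctE/= scaleN1r.
  ring.
apply: le_trans (lp_normD p1 _ _) _; apply: leeD.
  by rewrite lp_normZ// -[(-1)%R]mulN1r mulr1 normcN normc1 mul1e.
apply: lp_norm_leM => // x; rewrite normcM ler_wpM2r//.
exact: normc_ge0.
Qed.

End Approximation.

(** * Approximate units, and density of the coboundaries among the cocycles *)

Section Vanishing.
Variables (R : realType) (G : groupType) (S : {fset G}).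
Hypothesis S_gen : generates S.
Variables (p : R) (p1 : 1 <= p) (alpha : nat -> Lp G p1).
Hypothesis alpha_D0 : D_seminorm p S (alpha n) @[n --> \oo] --> 0%E.
Hypothesis alpha1_ncvg0 :
  ~ ((alpha n 1%g : R[i]^o) @[n --> \oo] --> (0 : R[i]^o)).
Implicit Types (g h x : G).

Lemma frequently_bounded_below : exists2 e : R, 0 < e &
  forall N : nat, exists2 n, (N <= n)%N & e <= normc (alpha n 1%g).
Proof.
apply: contrapT => He; apply: alpha1_ncvg0.
apply/cvgr0Pnorm_lt => e e0.
have eE : e = (complex.Re e)%:C by case: e e0 => a b /andP[/eqP/= ->].
have Re0 : 0 < complex.Re e by move: e0; rewrite {1}eE ltcR.
apply: contrapT => Hn; apply: He; exists (complex.Re e) => // N.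
apply: contrapT => HN; apply: Hn; exists N => // n /= Nn.
rewrite eE -[X in X < _]/((normc (alpha n 1%g))%:C) ltcR ltNge.
by apply/negP => en; apply: HN; exists n.
Qed.

Lemma bounded_approximate_unit : exists a : nat -> Lp G p1, [/\
  forall n x, normc (a n x) <= 2,
  forall x, normc (1 - a n x) @[n --> \oo] --> 0 &
  forall g, lp_norm p (rdiff (a n) g) @[n --> \oo] --> 0%E].
Proof.
have [e e0 /(_ _)/cid2 sub] := frequently_bounded_below.
(* The chosen indices need not increase; tending to infinity is enough. *)
pose f N := projT1 (sub N).
have fN N : (N <= f N)%N by rewrite /f; case: (sub N).
have fe N : e <= normc (alpha (f N) 1%g) by rewrite /f; case: (sub N).
have fy : f n @[n --> \oo] --> \oo.
  by apply/cvgnyPge => N; exists N => // n /= Nn; exact: leq_trans (fN n).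
pose c n := (alpha (f n) 1%g)^-1.
have c_le n : normc (c n) <= e^-1.
  by rewrite /c normcV lef_pV2 ?posrE// (lt_le_trans e0).
have aL n : (fun x => cclamp 1 (c n * alpha (f n) x)) \in lp_pred p1.
  apply: (lp_pred_leM (normc_ge0 (c n)) (valP (alpha (f n)))) => x.
  (* Clamping is 1-Lipschitz and fixes 0, hence does not increase the modulus. *)
  rewrite -normcM -[X in normc X]subr0 -(cclamp0 ler01) -[in leRHS](subr0 (_ * _)).
  exact: cclamp_dist.
pose a n := MkLp (aL n).
have da0 g : lp_norm p (rdiff (a n) g) @[n --> \oo] --> 0%E.
  have H : (e^-1%:E * lp_norm p (rdiff (alpha (f n)) g))%E @[n --> \oo] --> 0%E.
    rewrite -(mule0 e^-1%:E); apply: cvgeZl => //.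
    exact: (cvg_comp _ _ fy (rdiff_cvg0 p1 S_gen alpha_D0 g)).
  apply: squeeze_cvge (@cvg_cst _ 0%E _ _ _) H.
  apply: nearW => n; rewrite lp_norm_ge0/=.
  apply: lp_norm_leM => // [|x]; first by rewrite invr_ge0 ltW.
  apply: le_trans (cclamp_dist _ _ _) _.
  rewrite -mulrBr normcM; apply: ler_wpM2r; first exact: normc_ge0.
  exact: c_le.
exists a; split=> // [n x|x].
  by rewrite -[leRHS]mulr1; exact: cclamp_bound.
have a1 n : a n 1%g = 1.
  rewrite /= mulVf; first by rewrite cclamp_id// normc1.
  by apply/eqP => a0; move: (fe n); rewrite a0 normc0 leNgt e0.
(* At the identity, [rdiff (a n) x^-1] takes the value [a n x - 1], so its norm bounds the distance
   from [a n x] to 1. *)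
have dx0 := da0 x^-1%g; apply/cvgr0Pnorm_le => r r0.
move/ge0_cvge0P: dx0 => /(_ (fun=> lp_norm_ge0 _ _) _ r0).
apply: filterS => n nr; rewrite ger0_norm ?normc_ge0// -lee_fin.
apply: le_trans nr; apply: le_trans (normc_le_lp_norm p1 _ 1%g).
by rewrite /rdiff /rtrans !fctE invgK mul1g a1 lee_fin -normcN opprB.
Qed.

(* A cocycle is the coboundary of the function x |-> d(x^-1)(1), which need not
   be in L^p. *)
Lemma Z1E (d : cochains G p1) : Z1 G p1 d ->
  forall g, (d g : G -> R[i]) = rdiff (fun x => d x^-1%g 1%g) g.
Proof.
(* The cocycle identity for [g * x^-1] is evaluated at 1, where translation by [x^-1] yields the
   value of [d g] at [x]. *)
move=> dZ g; apply/funext => x; rewrite /rdiff /rtrans !fctE invgM invgK dZ.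
rewrite -[LHS](addrK (d x^-1%g 1%g)); congr (_ - _).
by rewrite -[RHS]/(d g (1 * x^-1^-1)%g + d x^-1%g 1%g) invgK mul1g.
Qed.

(** Two successive limits, in [n] and then in [N], each stay in the closed set [closure (B1 G p1)],
    so no diagonal sequence has to be extracted. *)
Lemma Z1_sub_closure_B1 : Z1 G p1 `<=` closure (B1 G p1).
Proof.
move=> d dZ; have [a [a2 a1 da0]] := bounded_approximate_unit.
pose b x := d x^-1%g 1%g.
have dE g : (d g : G -> R[i]) = rdiff b g := Z1E dZ g.
pose bN N x := cclamp (N%:R : R) (b x).
have dbN_le N g x : normc (rdiff (bN N) g x) <= 1 * normc (d g x).
  by rewrite mul1r dE; exact: cclamp_dist.
have dbNL N g : rdiff (bN N) g \in lp_pred p1.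
  exact: lp_pred_leM ler01 (valP (d g)) (dbN_le N g).
pose dN N : cochains G p1 := fun g => MkLp (dbNL N g).
have dN_closure N : closure (B1 G p1) (dN N).
  have bK x : normc (bN N x) <= 2 * N%:R by exact: cclamp_bound.
  have K0 : 0 <= 2 * N%:R :> R by rewrite mulr_ge0.
  have [A A_cvg] := bounded_approximation K0 a2 a1 da0 bK (dbNL N).
  pose dA n : cochains G p1 := fun g => Lp_act (A n) g - A n.
  apply: (@closed_cvg _ _ \oo _ dA _ (@closed_closure _ (B1 G p1))).
    by apply: nearW => n; apply: subset_closure; exists (A n).
  by apply: ptws_cvg => g; apply: Lp_cvg; exact: A_cvg.
apply: (@closed_cvg _ _ \oo _ dN _ (@closed_closure _ (B1 G p1))).
  exact: nearW.
apply: ptws_cvg => g; apply: Lp_cvg.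
(* Clamping contracts differences, so [d g] bounds both terms; this gives the factor 2. *)
apply: (@lp_norm_dominated_cvg0 _ _ _ p1 2 (d g)) => //.
- exact: (valP (d g)).
- move=> N x; apply: le_trans (le_normcD _ _) _; rewrite normcN.
  by have := dbN_le N g x; rewrite /=; lra.
- move=> x; apply/cvgr0Pnorm_le => e e0.
  (* Once [N] exceeds both moduli, neither value is clamped and the difference at [x] is exactly
     0. *)
  have := @nbhs_infty_ger R (Num.max (normc (b (x * g^-1)%g)) (normc (b x))).
  apply: filterS => N /=; rewrite ge_max => /andP[N1 N2].
  by rewrite dE !fctE /rdiff /rtrans !fctE /bN !cclamp_id// subrr normc0 normr0 ltW.
Qed.

End Vanishing.

(** * From density to the vanishing of the quotient *)

Lemma reduced_H1_eq0 (R : realType) (G : groupType) (p : R) (p1 : 1 <= p) :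
  Z1 G p1 `<=` closure (B1 G p1) -> reduced_H1 G p1 = [set zero_class G p1].
Proof.
move=> ZB.
have B1_closureE : B1_closure G p1 = Z1 G p1 by apply/setIidl.
have Z1D (c d : cochains G p1) : Z1 G p1 c -> Z1 G p1 d ->
    Z1 G p1 (fun g => c g + d g).
  move=> cZ dZ g h; rewrite cZ dZ addrACA; congr (_ + _).
  exact: val_inj.
have Z1N (d : cochains G p1) : Z1 G p1 d -> Z1 G p1 (fun g => - d g).
  by move=> dZ g h; rewrite dZ opprD; congr (_ + _); exact: val_inj.
have Z10 : Z1 G p1 (fun=> 0).
  by move=> g h; rewrite addr0; exact: val_inj.
(* The cocycles form an additive group, so a coset of all of them by one of them is again the whole
   group. *)
have classE (d : cochains G p1) : Z1 G p1 d -> cohomology_class d = Z1 G p1.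
  move=> dZ; rewrite /cohomology_class B1_closureE; apply/seteqP; split=> c /=.
    by move=> [b bZ <-]; exact: Z1D.
  move=> cZ; exists (fun g => c g - d g); first exact: Z1D (Z1N _ dZ).
  by apply/funext => g; rewrite addrC subrK.
apply/seteqP; split=> [_ [d dZ <-]|_ ->] /=.
  by rewrite /zero_class !classE.
by exists (fun=> 0).
Qed.

Theorem theorem3p2 (R : realType) (G : groupType) (S : {fset G})
    (S_sym : symmetric_fset S) (S_gen : generates S)
    (G_inf : infinite_set [set: G])
    (p : R) (p1 : 1 <= p) (alpha : nat -> Lp G p1)
    (alpha_D0 : D_seminorm p S (alpha n) @[n --> \oo] --> 0%E)
    (alpha_ncvg0 : forall x : G,
      ~ ((alpha n x : R[i]^o) @[n --> \oo] --> (0 : R[i]^o))) :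
  reduced_H1 G p1 = [set zero_class G p1].
Proof.
exact/reduced_H1_eq0/(Z1_sub_closure_B1 S_gen alpha_D0 (alpha_ncvg0 1%g)).
Qed.
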